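(* Let $J\in\mathbb N_0$, let $\Psi=\{\alpha;\beta^1,\ldots,\beta^r\}\subset L_1(\mathbb R)$ be generators and $\Theta=\{a;b^1,\ldots,b^r\}\subset\ell_1(\mathbb Z)$ a filter bank such that $$\widehat\alpha(2\xi)=\widehat a(\xi)\widehat\alpha(\xi),\qquad\widehat{\beta^k}(2\xi)=\widehat{b^k}(\xi)\widehat\alpha(\xi),\quad k=1,\ldots,r,\ \xi\in\mathbb R,$$ $$\left|\widehat a(\lambda_\ell/2^j)\right|^2+\sum_{k=1}^r\left|\widehat{b^k}(\lambda_\ell/2^j)\right|^2=1,\qquad\ell\in\Lambda_j^\alpha,\ j>J,$$ $|\widehat\alpha(0)|=1$ and $\operatorname{supp}\widehat\alpha\cap[0,\infty)\subset[0,1/2]$. Fix $f\in L^2(\mathcal M,\mu)$ and a level $j>J$. Define the coefficient functions $$v_j(y):=\langle f,\varphi_{j,y}\rangle,\qquad v_{j-1}(y):=\langle f,\varphi_{j-1,y}\rangle,\qquad w^k_{j-1}(y):=\langle f,\psi^k_{j-1,y}\rangle,\quad k=1,\ldots,r.$$ Let $\mathbf v_j$ and $\mathbf v_{j-1}$ be the weighted nodal sequences of $v_j$ and $v_{j-1}$ on $\boldsymbol X_j$ and $\boldsymbol X_{j-1}$, respectively, and let $\mathbf w^k_{j-1}$ be the weighted nodal sequence of $w^k_{j-1}$ on $\boldsymbol X_j$. Then $$\mathbf v_{j-1}=(\mathbf v_j*_ja^* )\downarrow_j,\qquad\mathbf w^k_{j-1}=\mathbf v_j*_j(b^k)^*,\quad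 k=1,\ldots,r.$$
   Context: $(\mathcal M,g)$ is a compact, connected, $d$-dimensional smooth Riemannian manifold without boundary, $\mu$ its normalized Riemannian volume measure. $\{u_\ell\}_{\ell\ge0}$ is an orthonormal basis of $L^2(\mu)$ with $-\Delta_{\mathcal M}u_\ell=\lambda_\ell^2u_\ell$ ($\Delta_{\mathcal M}$ the Laplace--Beltrami operator), $0=\lambda_0\le\lambda_1\le\cdots\to\infty$; $\langle f,g\rangle=\int f\overline g\,d\mu$, $\mathbb P_n=\operatorname{span}\{u_\ell:\lambda_\ell\le n\}$. Fourier conventions: $\widehat h(\xi)=\int_{\mathbb R}h(t)e^{-2\pi it\xi}dt$ for $h\in L_1(\mathbb R)$, $\widehat h(\xi)=\sum_{m\in\mathbb Z}h_me^{-2\pi im\xi}$ for $h\in\ell_1(\mathbb Z)$. For a filter $h$, $h^*$ is the filter with $\widehat{h^*}(\xi)=\overline{\widehat h(\xi)}$ for real $\xi$. Framelet kernels: $\varphi_{j,y}(x)=\sum_{\ell\ge0}\widehat\alpha(\lambda_\ell/2^j)\overline{u_\ell(y)}u_\ell(x)$ and $\psi^k_{j,y}(x)=\sum_{\ell\ge0}\widehat{\beta^k}(\lambda_\ell/2^j)\overline{u_\ell(y)}u_\ell(x)$. Active index sets: $\Lambda_j^\alpha=\{\ell\ge0:\widehat\alpha(\lambda_\ell/2^j)\ne0\}$, with the standing assumption $\Lambda_{j-1}^\alpha\subset\Lambda_j^\alpha$. Sampling: nested finite sets $\boldsymbol X_{j}\subset\boldsymbol X_{j+1}\subset\mathcal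 M$ with positive weights $w_{j,x}$ satisfying, at each level, an $L^2$ Marcinkiewicz--Zygmund inequality $A_j\|P\|^2_{L^2(\mu)}\le\sum_{x\in\boldsymbol X_j}w_{j,x}|P(x)|^2\le B_j\|P\|^2_{L^2(\mu)}$, $P\in\mathbb P_{2^j}$, with $0<A_j\le B_j<\infty$; consequently the map $\mathbf F_j:\mathbb C^{\Lambda_j^\alpha}\to\mathbb C^{\boldsymbol X_j}$, $(\mathbf F_j\widehat{\mathbf z})(x)=\sum_{\ell\in\Lambda_j^\alpha}z_\ell w_{j,x}^{1/2}u_\ell(x)$, is injective. The weighted nodal sequence on $\boldsymbol X_i$ of a function $v$ is $(w_{i,x}^{1/2}v(x))_{x\in\boldsymbol X_i}$. Operations on a sequence $\mathbf v_j=\mathbf F_j\widehat{\mathbf v}_j$ with spectral vector $\widehat{\mathbf v}_j=(\widehat v_{j,\ell})_{\ell\in\Lambda_j^\alpha}$: for a filter $h$, $$(\mathbf v_j*_jh)_x=\sum_{\ell\in\Lambda_j^\alpha}\widehat v_{j,\ell}\,\widehat h(\lambda_\ell/2^j)\,w_{j,x}^{1/2}u_\ell(x),\quad x\in\boldsymbol X_j,$$ (so $\mathbf v_j*_jh$ has spectral vector $(\widehat v_{j,\ell}\widehat h(\lambda_\ell/2^j))_{\ell\in\Lambda_j^\alpha}$), and the downsampling $$(\mathbf v_j\downarrow_j)_x=\sum_{\ell\in\Lambda_j^\alpha}\widehat v_{j,\ell}\,w_{j-1,x}^{1/2}u_\ell(x),\quad x\in\boldsymbol X_{j-1}.$$ 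*)

(* Defs.v *)
From HB Require Import structures.
From mathcomp Require Import all_boot all_order all_algebra finmap complex.
From mathcomp Require Import all_classical all_reals all_analysis.

Set Implicit Arguments.
Unset Strict Implicit.
Unset Printing Implicit Defensive.

Import Order.TTheory GRing.Theory Num.Theory.
Import numFieldNormedType.Exports.

Local Open Scope classical_set_scope.
Local Open Scope ring_scope.
Local Open Scope complex_scope.

Notation borel T := (g_sigma_algebraType (@open T)).

Section Smooth.
Context {R : realType} {d : nat}.

Definition partial (i : 'I_d) (f : 'rV[R]_d -> R) : 'rV[R]_d -> R :=
  fun x => 'D_(delta_mx ord0 i) f x.

Fixpoint Ck (k : nat) (U : set 'rV[R]_d) (f : 'rV[R]_d -> R) : Prop :=
  (forall x, U x -> {for x, continuous f}) /\
  if k is k'.+1 then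
    forall i : 'I_d,
      (forall x, U x -> derivable f x (delta_mx ord0 i)) /\
      Ck k' U (partial i f)
  else True.

Definition smooth_on (U : set 'rV[R]_d) (f : 'rV[R]_d -> R) : Prop :=
  forall k, Ck k U f.

(* The library constructs Lebesgue measure on R only; its values on half-open
   boxes determine it uniquely as a Borel measure on R^d. *)
Definition is_lebesgue_rV (leb : {measure set (borel 'rV[R]_d) -> \bar R}) :
    Prop :=
  forall p q : 'rV[R]_d, (forall i, p ord0 i <= q ord0 i) ->
    leb [set x | forall i, p ord0 i <= x ord0 i < q ord0 i] =
    (\prod_(i < d) (q ord0 i - p ord0 i))%:E.

End Smooth.

(* A smooth atlas on M together with a Riemannian metric given by its matrices
   of components in the charts.  [chart_inv a] and [metric a] are meaningful
   on the open set [chart a @` chart_dom a] only.  [metric_change] is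
   g_a = J g_b J^T with J_(i,k) = d tau_k / d x_i for the transition map
   tau = chart b \o chart_inv a. *)
Record riemannian_manifold (R : realType) (d : nat) (M : ptopologicalType) := {
  chart_index : Type;
  chart_dom : chart_index -> set M;
  chart : chart_index -> M -> 'rV[R]_d;
  chart_inv : chart_index -> 'rV[R]_d -> M;
  chart_at : M -> chart_index;
  metric : chart_index -> 'rV[R]_d -> 'M[R]_d;
  chart_dom_open : forall a, open (chart_dom a);
  chart_cod_open : forall a, open (chart a @` chart_dom a);
  chartK : forall a p, chart_dom a p -> chart_inv a (chart a p) = p;
  chart_continuous : forall a p, chart_dom a p ->
    {for p, continuous (chart a)};
  chart_inv_continuous : forall a x, (chart a @` chart_dom a) x ->
    {for x, continuous (chart_inv a)};
  mem_chart_at : forall p, chart_dom (chart_at p) p;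
  transition_smooth : forall a b (k : 'I_d),
    smooth_on (chart a @` (chart_dom a `&` chart_dom b))
      (fun x => chart b (chart_inv a x) ord0 k);
  metric_smooth : forall a (i k : 'I_d),
    smooth_on (chart a @` chart_dom a) (fun x => metric a x i k);
  metric_sym : forall a x, (chart a @` chart_dom a) x ->
    (metric a x)^T = metric a x;
  metric_pos : forall a x, (chart a @` chart_dom a) x ->
    forall v : 'rV[R]_d, v != 0 -> 0 < (v *m metric a x *m v^T) ord0 ord0;
  metric_change : forall a b x,
    (chart a @` (chart_dom a `&` chart_dom b)) x ->
    let J := \matrix_(i < d, k < d)
      partial i (fun y => chart b (chart_inv a y) ord0 k) x in
    metric a x = J *m metric b (chart b (chart_inv a x)) *m J^T }.

Section Riemannian.
Context {R : realType} {d : nat} {M : ptopologicalType}.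
Variable g : riemannian_manifold R d M.

Definition vol_density (a : chart_index g) (x : 'rV[R]_d) : R :=
  Num.sqrt (\det (metric a x)).

Definition is_riemannian_volume (vol : {measure set (borel M) -> \bar R}) :
    Prop :=
  exists2 leb : {measure set (borel 'rV[R]_d) -> \bar R},
    is_lebesgue_rV leb &
    forall (a : chart_index g) (B : set (borel 'rV[R]_d)),
      measurable B -> B `<=` chart a @` chart_dom a ->
      vol (chart_dom a `&` chart a @^-1` B) =
      (\int[leb]_(x in B) (vol_density a x)%:E)%E.

Definition is_normalized_volume (mu : {measure set (borel M) -> \bar R}) :
    Prop :=
  exists2 vol : {measure set (borel M) -> \bar R},
    is_riemannian_volume vol &
    forall A : set (borel M), measurable A ->
      mu A = (fine (vol A) / fine (vol [set: M]))%:E.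

Definition smooth_fun (v : M -> R) : Prop :=
  forall a : chart_index g,
    smooth_on (chart a @` chart_dom a) (v \o @chart_inv _ _ _ g a).

(* |g|^(-1/2) \sum_i d_i (|g|^(1/2) \sum_k g^(ik) d_k h) *)
Definition laplace_coord (a : chart_index g) (h : 'rV[R]_d -> R)
    (x : 'rV[R]_d) : R :=
  (vol_density a x)^-1 *
  \sum_(i < d) partial i
    (fun y => vol_density a y *
       \sum_(k < d) invmx (metric a y) i k * partial k h y) x.

(* On smooth functions the value does not depend on the chart around p. *)
Definition laplace_beltrami (v : M -> R) (p : M) : R :=
  let a := chart_at g p in
  laplace_coord a (v \o @chart_inv _ _ _ g a) (chart a p).

Definition claplace_beltrami (v : M -> R[i]) (p : M) : R[i] :=
  laplace_beltrami (@complex.Re R \o v) p +i*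
  laplace_beltrami (@complex.Im R \o v) p.

Definition csmooth_fun (v : M -> R[i]) : Prop :=
  smooth_fun (@complex.Re R \o v) /\ smooth_fun (@complex.Im R \o v).

End Riemannian.

Section ComplexIntegral.
Context {R : realType} {disp : measure_display} {T : measurableType disp}.
Variable mu : {measure set T -> \bar R}.

Definition cintegrable (F : T -> R[i]) : Prop :=
  mu.-integrable setT (fun x => (complex.Re (F x))%:E) /\
  mu.-integrable setT (fun x => (complex.Im (F x))%:E).

Definition cintegral (F : T -> R[i]) : R[i] :=
  Rintegral mu setT (fun x => complex.Re (F x)) +i*
  Rintegral mu setT (fun x => complex.Im (F x)).

Definition L2norm_sq (F : T -> R[i]) : \bar R :=
  (\int[mu]_x (Normc.normc (F x) ^+ 2)%:E)%E.

Definition in_L2 (F : T -> R[i]) : Prop :=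
  [/\ measurable_fun setT (@complex.Re R \o F),
      measurable_fun setT (@complex.Im R \o F) &
      (L2norm_sq F < +oo)%E].

Definition inner (F G : T -> R[i]) : R[i] :=
  cintegral (fun x => F x * conjc (G x)).

Definition orthonormal_basis (u : nat -> T -> R[i]) : Prop :=
  [/\ forall l, in_L2 (u l),
      forall k l, inner (u k) (u l) = (k == l)%:R &
      forall F, in_L2 F -> forall e : R, 0 < e ->
        exists (n : nat) (c : nat -> R[i]),
          (L2norm_sq (fun x => (F x - \sum_(l < n) c l * u l x)%R) < e%:E)%E].

End ComplexIntegral.

Section Fourier.
Context {R : realType}.

Definition climn (s : nat -> R[i]) : R[i] :=
  limn (fun n => complex.Re (s n)) +i* limn (fun n => complex.Im (s n)).

Definition cexpi (t : R) : R[i] := cos t +i* sin t.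

Definition in_L1 (h : R -> R[i]) : Prop := cintegrable (@lebesgue_measure R) h.

Definition fourier (h : R -> R[i]) (xi : R) : R[i] :=
  cintegral (@lebesgue_measure R)
    (fun t : R => h t * cexpi (- (2 * pi * t * xi))).

Definition in_ell1 (h : int -> R[i]) : Prop :=
  summable [set: int] (fun m => (Normc.normc (h m))%:E).

(* Limit of the symmetric partial sums over -n <= m <= n; the order is
   immaterial for h in ell_1. *)
Definition fourier_series (h : int -> R[i]) (xi : R) : R[i] :=
  climn (fun n => \sum_(k < n.*2.+1)
    let m : int := k%:Z - n%:Z in
    h m * cexpi (- (2 * pi * m%:~R * xi))).

Definition is_adjoint_filter (h hstar : int -> R[i]) : Prop :=
  in_ell1 hstar /\
  forall xi : R, fourier_series hstar xi = conjc (fourier_series h xi).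

End Fourier.

Section Framelets.
Context {R : realType} {M : ptopologicalType}.
Variables (lam : nat -> R) (u : nat -> M -> R[i]).

Definition diffusion_space (n : R) : set (M -> R[i]) :=
  [set P | exists (s : seq nat) (c : nat -> R[i]),
     (forall l, l \in s -> lam l <= n) /\
     P = (fun x => \sum_(l <- s) c l * u l x)].

(* phi_(j,y) for [gen] = alpha and psi^k_(j,y) for [gen] = beta^k *)
Definition framelet (gen : R -> R[i]) (j : nat) (y x : M) : R[i] :=
  climn (fun n => \sum_(l < n)
    fourier gen (lam l / 2 ^+ j) * conjc (u l y) * u l x).

Definition framelet_coeff (mu : {measure set (borel M) -> \bar R})
    (f : M -> R[i]) (gen : R -> R[i]) (j : nat) (y : M) : R[i] :=
  inner mu f (framelet gen j y).

Definition active (alpha : R -> R[i]) (j : nat) : set nat :=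
  [set l | fourier alpha (lam l / 2 ^+ j) != 0].

Definition marcinkiewicz_zygmund (mu : {measure set (borel M) -> \bar R})
    (n : R) (Y : {fset M}) (w : M -> R) (A B : R) : Prop :=
  forall P, diffusion_space n P ->
    (A%:E * L2norm_sq mu (P : borel M -> R[i])
       <= (\sum_(x <- Y) w x * Normc.normc (P x) ^+ 2)%R%:E)%E /\
    ((\sum_(x <- Y) w x * Normc.normc (P x) ^+ 2)%R%:E
       <= B%:E * L2norm_sq mu (P : borel M -> R[i]))%E.

Variables (X : nat -> {fset M}) (w : nat -> M -> R).

Definition nodal_seq (i : nat) (v : M -> R[i]) : {ffun X i -> R[i]} :=
  [ffun x => (Num.sqrt (w i (val x)))%:C * v (val x)].

(* C^L, encoded as the sequences supported in L. *)
Definition spectral_space (L : set nat) : set (nat -> R[i]) :=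
  [set z | forall l, ~ L l -> z l = 0].

Definition synthesis (L : set nat) (i : nat) (z : nat -> R[i]) :
    {ffun X i -> R[i]} :=
  [ffun x => \sum_(l \in L) z l * (Num.sqrt (w i (val x)))%:C * u l (val x)].

Variables (alpha : R -> R[i]) (j : nat).

Definition Fmap : (nat -> R[i]) -> {ffun X j -> R[i]} :=
  synthesis (active alpha j) j.

(* The preimage under F_j of a sequence in its range; F_j is injective on
   C^(Lambda_j) under the Marcinkiewicz-Zygmund inequality. *)
Definition spectral_vector (v : {ffun X j -> R[i]}) : nat -> R[i] :=
  xget (fun=> 0) (spectral_space (active alpha j) `&` Fmap @^-1` [set v]).

Definition convolve (v : {ffun X j -> R[i]}) (h : int -> R[i]) :
    {ffun X j -> R[i]} :=
  Fmap (fun l => spectral_vector v l * fourier_series h (lam l / 2 ^+ j)).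

Definition downsample (v : {ffun X j -> R[i]}) : {ffun X j.-1 -> R[i]} :=
  synthesis (active alpha j) j.-1 (spectral_vector v).

End Framelets.

(* Main.v *)
Require Import Defs.
From HB Require Import structures.
From mathcomp Require Import all_boot all_order all_algebra finmap complex.
From mathcomp Require Import all_classical all_reals all_analysis.
From mathcomp Require Import ring measurable_realfun.

Import Order.TTheory GRing.Theory Num.Theory.
Import numFieldNormedType.Exports.

Local Open Scope classical_set_scope.
Local Open Scope ring_scope.
Local Open Scope complex_scope.

(* The refinement equations give every generator at level j-1 the Fourier
   factor of alpha at level j, so all the sums involved are finite sums over
   the active set of level j, and v_j, v_(j-1), w^k_(j-1) are the synthesis of
   the spectral vectors conj(gen^(lam_l / 2^i)) <f, u_l>.  By the lower
   Marcinkiewicz-Zygmund bound a diffusion polynomial vanishing on X_j has zero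
   L^2 norm, hence zero coefficients: F_j is injective, the spectral vector of
   v_j is the expected one, and the identities hold coefficientwise. *)

(** * Complex arithmetic and limits, component by component *)

Section ComplexNumbers.
Context {R : realType}.
Implicit Types x y z : R[i].

Lemma ReMc x y : complex.Re (x * y) =
  complex.Re x * complex.Re y - complex.Im x * complex.Im y.
Proof. by case: x => ? ?; case: y. Qed.

Lemma ImMc x y : complex.Im (x * y) =
  complex.Re x * complex.Im y + complex.Im x * complex.Re y.
Proof. by case: x => ? ?; case: y. Qed.

Lemma ReDc x y : complex.Re (x + y) = complex.Re x + complex.Re y.
Proof. by case: x => ? ?; case: y. Qed.

Lemma ImDc x y : complex.Im (x + y) = complex.Im x + complex.Im y.
Proof. by case: x => ? ?; case: y. Qed.

Lemma complex_eq x y :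
  complex.Re x = complex.Re y -> complex.Im x = complex.Im y -> x = y.
Proof. by case: x => ? ?; case: y => ? ? /= -> ->. Qed.

Lemma sqr_normcE z :
  Normc.normc z ^+ 2 = complex.Re z ^+ 2 + complex.Im z ^+ 2.
Proof. by case: z => p q /=; rewrite sqr_sqrtr// addr_ge0 ?sqr_ge0. Qed.

Lemma mulc_conj z : z * conjc z = (Normc.normc z ^+ 2)%:C.
Proof.
by apply: complex_eq; rewrite ?ReMc ?ImMc sqr_normcE; case: z => p q /=;
  rewrite ?mulrN ?opprK -?expr2 // [p * q]mulrC addNr.
Qed.

Lemma sqr_normc_eq0 z : Normc.normc z ^+ 2 = 0 -> z = 0.
Proof. by move/eqP; rewrite expf_eq0 => /andP[_ /eqP/Normc.eq0_normc]. Qed.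

Lemma climn_near_cst (s : nat -> R[i]) z :
  (\forall n \near \oo, s n = z) -> climn s = z.
Proof.
move=> sz; apply: complex_eq; apply: (lim_near_cst (@Rhausdorff R));
  by apply: filterS sz => n ->.
Qed.

End ComplexNumbers.

(** * Complex-valued integrals and the inner product of L^2 *)

Section ComplexIntegration.
Context {R : realType} {disp : measure_display} {T : measurableType disp}.
Variable mu : {measure set T -> \bar R}.
Implicit Types (F G : T -> R[i]) (c z : R[i]).

Lemma cintegral0 :
  cintegrable mu (fun=> 0) /\ cintegral mu (fun=> 0) = 0.
Proof.
split; first by split => /=; exact: integrable0.
by apply: complex_eq => /=; rewrite Rintegral_cst// mul0r.
Qed.

Lemma cintegralD F G : cintegrable mu F -> cintegrable mu G ->
  cintegrable mu (fun x => F x + G x) /\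
  cintegral mu (fun x => F x + G x) = cintegral mu F + cintegral mu G.
Proof.
move=> [F1 F2] [G1 G2]; split; first split.
- have := integrableD measurableT F1 G1.
  by apply: eq_integrable => // x _; rewrite ReDc EFinD.
- have := integrableD measurableT F2 G2.
  by apply: eq_integrable => // x _; rewrite ImDc EFinD.
apply: complex_eq => /=.
- rewrite -(RintegralD measurableT F1 G1).
  by apply: eq_Rintegral => x _; rewrite ReDc.
- rewrite -(RintegralD measurableT F2 G2).
  by apply: eq_Rintegral => x _; rewrite ImDc.
Qed.

Lemma cintegralZ c F : cintegrable mu F ->
  cintegrable mu (fun x => c * F x) /\
  cintegral mu (fun x => c * F x) = c * cintegral mu F.
Proof.
move=> [F1 F2]; set p := complex.Re c; set q := complex.Im c.
have Zi k (h : T -> R) : mu.-integrable setT (EFin \o h) ->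
    mu.-integrable setT (EFin \o (fun x => k * h x)).
  move=> /(integrableZl measurableT k).
  by apply: eq_integrable => // x _; rewrite /= EFinM.
split; first split.
- have := integrableB measurableT (Zi p _ F1) (Zi q _ F2).
  by apply: eq_integrable => // x _; rewrite ReMc EFinB.
- have := integrableD measurableT (Zi p _ F2) (Zi q _ F1).
  by apply: eq_integrable => // x _; rewrite ImMc EFinD.
apply: complex_eq.
- rewrite ReMc /= -/p -/q -(RintegralZl p measurableT F1).
  rewrite -(RintegralZl q measurableT F2).
  rewrite -(RintegralB measurableT (Zi p _ F1) (Zi q _ F2)).
  by apply: eq_Rintegral => x _; rewrite ReMc.
- rewrite ImMc /= -/p -/q -(RintegralZl p measurableT F2).
  rewrite -(RintegralZl q measurableT F1).
  rewrite -(RintegralD measurableT (Zi p _ F2) (Zi q _ F1)).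
  by apply: eq_Rintegral => x _; rewrite ImMc.
Qed.

(** Integrability is proved together with the value, since additivity in the induction step requires
    it of the partial sum. *)
Lemma cintegral_sum n (c : nat -> R[i]) (F : nat -> T -> R[i]) :
  (forall l, cintegrable mu (F l)) ->
  cintegrable mu (fun x => \sum_(l < n) c l * F l x) /\
  cintegral mu (fun x => \sum_(l < n) c l * F l x) =
  \sum_(l < n) c l * cintegral mu (F l).
Proof.
move=> Fi; elim: n => [|n [IHi IHe]].
  under eq_fun do rewrite big_ord0.
  by rewrite big_ord0; exact: cintegral0.
under eq_fun do rewrite big_ord_recr /=.
have [Zi Ze] := cintegralZ (c n) _ (Fi n).
have [Di De] := cintegralD _ _ IHi Zi.
by split=> //; rewrite De IHe Ze big_ord_recr.
Qed.

Lemma in_L2_integrable F : in_L2 mu F ->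
  mu.-integrable setT (EFin \o (fun x => Normc.normc (F x) ^+ 2)).
Proof.
move=> [F1 F2 Foo]; apply/integrableP; split.
  apply/measurable_EFinP.
  under eq_fun do rewrite sqr_normcE.
  by apply: measurable_funD; exact: measurable_funX.
rewrite /L2norm_sq in Foo; under eq_integral do rewrite gee0_abs ?lee_fin ?sqr_ge0//.
exact: Foo.
Qed.

(** Both components of F conj(G) are dominated by |F|^2 + |G|^2, which is integrable. *)
Lemma cintegrable_mul_conj F G : in_L2 mu F -> in_L2 mu G ->
  cintegrable mu (fun x => F x * conjc (G x)).
Proof.
move=> F2 G2.
have FGi := integrableD measurableT (in_L2_integrable _ F2) (in_L2_integrable _ G2).
have reJ z : complex.Re (conjc z) = complex.Re z by case: z.
have imJ z : complex.Im (conjc z) = - complex.Im z by case: z.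
(* Here a, c are the components of F and b, d those of G, so the right-hand side is |F|^2 +
   |G|^2. *)
have bnd (a b c d e : R) : `|e| <= `|a * b| + `|c * d| ->
    `|e| <= a ^+ 2 + c ^+ 2 + (b ^+ 2 + d ^+ 2).
  move=> /le_trans; apply.
  have h (x y : R) : `|x * y| <= x ^+ 2 + y ^+ 2.
    rewrite normrM -(real_normK (num_real x)) -(real_normK (num_real y)).
    (* With p = |x| and q = |y|, the two nonnegative terms (p - q)^2 and pq add up to p^2 + q^2 -
       pq. *)
    have : 0 <= (`|x| - `|y|) ^+ 2 := sqr_ge0 _.
    have : 0 <= `|x| * `|y| by rewrite mulr_ge0.
    move: `|x| `|y| => p q; rewrite sqrrB mulr2n => h1 h2.
    rewrite -subr_ge0; apply: (le_trans (addr_ge0 h1 h2)).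
    by rewrite le_eqVlt; apply/orP; left; apply/eqP; ring.
  by rewrite addrACA lerD.
case: F2 G2 => [F1 F2 _] [G1 G2 _].
split; apply: (le_integrable measurableT _ _ FGi).
- apply/measurable_EFinP; under eq_fun do rewrite ReMc reJ imJ.
  apply: measurable_funB; first exact: measurable_funM.
  by apply: measurable_funM => //; exact: measurableT_comp.
- move=> x _; rewrite /= !lee_fin ReMc reJ imJ.
  rewrite [leRHS]ger0_norm ?addr_ge0 ?sqr_ge0// !sqr_normcE.
  by apply: bnd; rewrite mulrN opprK ler_normD.
- apply/measurable_EFinP; under eq_fun do rewrite ImMc reJ imJ.
  apply: measurable_funD; last exact: measurable_funM.
  by apply: measurable_funM => //; exact: measurableT_comp.
- move=> x _; rewrite /= !lee_fin ImMc reJ imJ.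
  rewrite [leRHS]ger0_norm ?addr_ge0 ?sqr_ge0// !sqr_normcE.
  (* The imaginary part pairs Re F with Im G, so the components of G enter [bnd] in the opposite
     order. *)
  rewrite [complex.Re (G x) ^+ 2 + _]addrC; apply: bnd.
  by rewrite mulrN (le_trans (ler_normD _ _))// normrN.
Qed.

Lemma inner_suml n (c : nat -> R[i]) (u : nat -> T -> R[i]) G :
  (forall l, in_L2 mu (u l)) -> in_L2 mu G ->
  cintegrable mu (fun x => (\sum_(l < n) c l * u l x) * conjc (G x)) /\
  inner mu (fun x => \sum_(l < n) c l * u l x) G =
  \sum_(l < n) c l * inner mu (u l) G.
Proof.
move=> u2 G2; rewrite /inner.
have -> : (fun x => (\sum_(l < n) c l * u l x) * conjc (G x)) =
    fun x => \sum_(l < n) c l * (u l x * conjc (G x)).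
  by apply/funext => x; rewrite mulr_suml; under eq_bigr do rewrite -mulrA.
by apply: (cintegral_sum n c (fun l x => u l x * conjc (G x))) => l;
  exact: cintegrable_mul_conj.
Qed.

(** Only integrability against each u_l is assumed of F: this covers F in L^2, and also a finite
    combination of the u_l, for which [inner_suml] supplies it. *)
Lemma inner_sumr n (c : nat -> R[i]) (u : nat -> T -> R[i]) F :
  (forall l, cintegrable mu (fun x => F x * conjc (u l x))) ->
  inner mu F (fun x => \sum_(l < n) c l * u l x) =
  \sum_(l < n) conjc (c l) * inner mu F (u l).
Proof.
move=> Fu; rewrite /inner.
have -> : (fun x => F x * conjc (\sum_(l < n) c l * u l x)) =
    fun x => \sum_(l < n) conjc (c l) * (F x * conjc (u l x)).
  apply/funext => x; rewrite raddf_sum mulr_sumr; apply: eq_bigr => l _.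
  by rewrite [X in _ * X]rmorphM mulrCA.
exact: (cintegral_sum n (fun l => conjc (c l))
  (fun l x => F x * conjc (u l x)) Fu).2.
Qed.

(** By Parseval, <P, P> is the sum of the |c_l|^2; its real part is the squared norm, so every term
    vanishes. *)
Lemma orthonormal_L2norm0 n (c : nat -> R[i]) (u : nat -> T -> R[i]) :
  (forall l, in_L2 mu (u l)) ->
  (forall k l, inner mu (u k) (u l) = (k == l)%:R) ->
  L2norm_sq mu (fun x => \sum_(l < n) c l * u l x) = 0%E ->
  forall l, (l < n)%N -> c l = 0.
Proof.
move=> u2 uo P0 l ln; set P := fun x => _ in P0.
have PP0 : complex.Re (inner mu P P) = 0.
  rewrite /= /Rintegral; move: P0; rewrite /L2norm_sq.
  (* Writing |P|^2 as Re(P conj(P)) identifies the extended integral in [L2norm_sq] with the one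
     inside [Rintegral]. *)
  by under eq_integral do rewrite -[Normc.normc _ ^+ 2]/(complex.Re (_%:C))
    -mulc_conj; move=> ->.
have PPE : inner mu P P = (\sum_(l < n) Normc.normc (c l) ^+ 2)%:C.
  rewrite {2}/P inner_sumr => [|k]; last exact: (inner_suml n c u (u k) u2 _).1.
  rewrite raddf_sum; apply: eq_bigr => k _.
  rewrite (inner_suml n c u (u k) u2 _).2// (bigD1 k)//= uo eqxx mulr1.
  rewrite big1 ?addr0 => [|m mk]; first by rewrite mulrC mulc_conj.
  by move: mk; rewrite uo -val_eqE => /negbTE /= ->; rewrite mulr0.
move: PP0; rewrite PPE => /(psumr_eq0P (fun i _ => sqr_ge0 _)).
by move=> /(_ (Ordinal ln) isT) /sqr_normc_eq0.
Qed.

End ComplexIntegration.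

(** * Framelets and their coefficients as finite sums *)

Section FrameletCoefficients.
Context {R : realType} {M : ptopologicalType}.
Variables (lam : nat -> R) (u : nat -> M -> R[i]).

(** The support gives lam_l / 2^i <= 1/2 <= 1, which puts the active u_l in the diffusion space
    where the sampling inequality of level i holds. *)
Lemma active_le (alpha : R -> R[i]) i l : 0 <= lam l ->
  closure [set xi : R | fourier alpha xi != 0] `&` [set xi | 0 <= xi]
    `<=` [set xi | 0 <= xi <= 2^-1] ->
  active lam alpha i l -> lam l <= 2 ^+ i.
Proof.
move=> lam_ge0 supp al.
have /supp /andP[_ le2] : (closure [set xi : R | fourier alpha xi != 0] `&`
    [set xi | 0 <= xi]) (lam l / 2 ^+ i).
  by split; [exact: subset_closure | rewrite /= divr_ge0// exprn_ge0].
rewrite -[leRHS]mul1r -ler_pdivrMr ?exprn_gt0//.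
by rewrite (le_trans le2)// invf_le1// ler1n.
Qed.

Lemma framelet_sum (gen : R -> R[i]) i N y :
  (forall l, (N <= l)%N -> fourier gen (lam l / 2 ^+ i) = 0) ->
  framelet lam u gen i y = fun x =>
    \sum_(l < N) fourier gen (lam l / 2 ^+ i) * conjc (u l y) * u l x.
Proof.
move=> gen0; apply/funext => x; apply: climn_near_cst.
exists N => // n /= Nn; rewrite -(subnKC Nn) big_split_ord /=.
rewrite [X in _ + X]big1 ?addr0// => l _.
by rewrite gen0 ?mul0r// leq_addr.
Qed.

(** The inner product conjugates its second argument, so conj(u_l(y)) becomes u_l(y): the
    coefficient, as a function of y, is again an expansion in the u_l. *)
Lemma framelet_coeff_sum (mu : {measure set (borel M) -> \bar R}) f
    (gen : R -> R[i]) i N y :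
  (forall l, in_L2 mu (u l : borel M -> R[i])) ->
  in_L2 mu (f : borel M -> R[i]) ->
  (forall l, (N <= l)%N -> fourier gen (lam l / 2 ^+ i) = 0) ->
  framelet_coeff lam u mu f gen i y = \sum_(l < N)
    conjc (fourier gen (lam l / 2 ^+ i)) *
    inner mu (f : borel M -> R[i]) (u l) * u l y.
Proof.
move=> u2 f2 gen0; rewrite /framelet_coeff (framelet_sum _ _ _ _ gen0).
rewrite (inner_sumr mu N
  (fun l => fourier gen (lam l / 2 ^+ i) * conjc (u l y)) u).
  by apply: eq_bigr => l _; rewrite rmorphM /= conjcK mulrAC.
by move=> l; exact: cintegrable_mul_conj.
Qed.

(** * Synthesis on the nodes and injectivity of F_j *)

Variables (X : nat -> {fset M}) (w : nat -> M -> R).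

Lemma synthesis_sum (L : set nat) i N (z : nat -> R[i]) (x : X i) :
  L `<=` `I_N -> spectral_space L z ->
  synthesis u X w L i z x =
  (Num.sqrt (w i (val x)))%:C * \sum_(l < N) z l * u l (val x).
Proof.
(* Since z vanishes off L, the sum over L may be widened to all indices below N. *)
move=> LN z0; rewrite ffunE (fsbig_widen L `I_N) => //; last first.
  by move=> l [_ /= /z0 ->]; rewrite !mul0r.
rewrite -(fsbig_ord _ N (fun l => z l * (Num.sqrt (w i (val x)))%:C *
  u l (val x))) mulr_sumr.
by apply: eq_bigr => l _; rewrite mulrCA mulrA.
Qed.

Variables (mu : {measure set (borel M) -> \bar R}) (alpha : R -> R[i]).
Variables (j N : nat) (A B : R).
Hypothesis u_L2 : forall l, in_L2 mu (u l : borel M -> R[i]).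
Hypothesis u_orthonormal : forall k l,
  inner mu (u k : borel M -> R[i]) (u l) = (k == l)%:R.
Hypothesis w_pos : forall x, x \in X j -> 0 < w j x.
Hypothesis A_gt0 : 0 < A.
Hypothesis MZ : marcinkiewicz_zygmund lam u mu (2 ^+ j) (X j) (w j) A B.
Hypothesis active_lt : active lam alpha j `<=` `I_N.
Hypothesis active_lam : forall l, active lam alpha j l -> lam l <= 2 ^+ j.

Lemma Fmap_inj : {in spectral_space (active lam alpha j) &,
  injective (Fmap lam u X w alpha j)}.
Proof.
move=> z z' /set_mem zP /set_mem z'P eqF.
pose c l := z l - z' l.
have cP : spectral_space (active lam alpha j) c.
  by move=> l nl; rewrite /c zP// z'P// subrr.
pose P := fun x => \sum_(l < N) c l * u l x.
have PX x : x \in X j -> P x = 0.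
  move=> xX; have sw_neq0 : (Num.sqrt (w j x))%:C != 0 :> R[i].
    by rewrite (inj_eq (@complexI _)) sqrtr_eq0 -ltNge w_pos.
  have := congr1 (fun F : {ffun X j -> R[i]} => F [` xX]%fset) eqF.
  rewrite /Fmap !(synthesis_sum _ _ N)//= => /(mulfI sw_neq0) eqS.
  by rewrite /P; under eq_bigr do rewrite mulrBl; rewrite sumrB eqS subrr.
have Pdiff : diffusion_space lam u (2 ^+ j) P.
  (* Only active indices are listed, as the bound lam_l <= 2^j is known for these alone; the other
     coefficients of P are 0. *)
  exists [seq l <- iota 0 N | l \in active lam alpha j], c; split.
    by move=> l; rewrite mem_filter => /andP[/set_mem /active_lam].
  apply/funext => x; rewrite big_filter big_mkcond /=.
  rewrite -[N in iota 0 N]subn0 -/(index_iota 0 N) big_mkord.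
  apply: eq_bigr => l _; case: ifPn => // /negP nl.
  by rewrite cP ?mul0r// => /mem_set.
have [MZ1 _] := MZ _ Pdiff; move: MZ1.
rewrite big1_seq => [|x /andP[_ xX]]; last first.
  by rewrite PX// Normc.normc0 expr0n mulr0.
rewrite pmule_rle0 ?lte_fin// => P_le0.
have P0 : L2norm_sq mu (P : borel M -> R[i]) = 0%E.
  apply/eqP; rewrite eq_le P_le0 integral_ge0// => x _.
  by rewrite lee_fin sqr_ge0.
(* Below N the coefficients vanish by orthonormality; from N on no index is active, so z and z' are
   both 0 there. *)
have c0 := orthonormal_L2norm0 mu N c u u_L2 u_orthonormal P0.
apply/funext => l; have [lN|Nl] := ltnP l N.
  by apply/eqP; rewrite -subr_eq0 -/(c l) c0.
by rewrite zP ?z'P// => /active_lt /=; rewrite ltnNge Nl.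
Qed.

(** The set searched by [xget] contains z and, by injectivity, nothing else; hence the default value
    0 is not what is returned. *)
Lemma Fmap_spectral_vector z : spectral_space (active lam alpha j) z ->
  spectral_vector lam u w alpha (Fmap lam u X w alpha j z) = z.
Proof.
move=> zP; apply: xget_subset1 => // z1 z2 [z1P /= e1] [z2P /= e2].
by apply: Fmap_inj; rewrite ?inE// e1 e2.
Qed.

End FrameletCoefficients.

(** * One decomposition step, from level j to level j - 1 *)

Theorem theorem5p1 (R : realType) (d : nat) (M : ptopologicalType)
    (g : riemannian_manifold R d M)
    (M_hausdorff : hausdorff_space M)
    (M_compact : compact [set: M])
    (M_connected : connected [set: M])
    (mu : {measure set (borel M) -> \bar R})
    (mu_vol : is_normalized_volume g mu)
    (lam : nat -> R) (u : nat -> M -> R[i])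
    (u_basis : orthonormal_basis mu (u : nat -> borel M -> R[i]))
    (u_smooth : forall l, csmooth_fun g (u l))
    (u_eigen : forall l p,
      - claplace_beltrami g (u l) p = (lam l ^+ 2)%:C * u l p)
    (lam0 : lam 0%N = 0)
    (lam_nondecreasing : nondecreasing_seq lam)
    (lam_infty : lam @ \oo --> +oo)
    (X : nat -> {fset M}) (w : nat -> M -> R) (A B : nat -> R)
    (X_nested : forall j, (X j `<=` X j.+1)%fset)
    (w_pos : forall j x, x \in X j -> 0 < w j x)
    (AB : forall j, 0 < A j <= B j)
    (MZ : forall j,
      marcinkiewicz_zygmund lam u mu (2 ^+ j) (X j) (w j) (A j) (B j))
    (J r : nat)
    (alpha : R -> R[i]) (beta : 'I_r -> R -> R[i])
    (a : int -> R[i]) (b : 'I_r -> int -> R[i])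
    (alpha_L1 : in_L1 alpha) (beta_L1 : forall k, in_L1 (beta k))
    (a_ell1 : in_ell1 a) (b_ell1 : forall k, in_ell1 (b k))
    (active_nested : forall j, active lam alpha j `<=` active lam alpha j.+1)
    (refine_alpha : forall xi : R,
      fourier alpha (2 * xi) = fourier_series a xi * fourier alpha xi)
    (refine_beta : forall (k : 'I_r) (xi : R),
      fourier (beta k) (2 * xi) = fourier_series (b k) xi * fourier alpha xi)
    (partition_of_unity : forall j l, (J < j)%N -> active lam alpha j l ->
      Normc.normc (fourier_series a (lam l / 2 ^+ j)) ^+ 2 +
      \sum_(k < r) Normc.normc (fourier_series (b k) (lam l / 2 ^+ j)) ^+ 2 = 1)
    (alpha0 : Normc.normc (fourier alpha 0) = 1)
    (alpha_supp :
      closure [set xi : R | fourier alpha xi != 0] `&` [set xi | 0 <= xi]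
        `<=` [set xi | 0 <= xi <= 2^-1])
    (astar : int -> R[i]) (bstar : 'I_r -> int -> R[i])
    (astarP : is_adjoint_filter a astar)
    (bstarP : forall k, is_adjoint_filter (b k) (bstar k))
    (f : M -> R[i]) (f_L2 : in_L2 mu (f : borel M -> R[i]))
    (j : nat) (J_lt_j : (J < j)%N) :
  let v i := nodal_seq X w i (framelet_coeff lam u mu f alpha i) in
  let wk k := nodal_seq X w j (framelet_coeff lam u mu f (beta k) j.-1) in
  [/\ (* the sequence v_j is in the range of F_j, where the operations live *)
      (Fmap lam u X w alpha j @` spectral_space (active lam alpha j)) (v j),
      v j.-1 = downsample lam u w alpha (convolve lam u w alpha (v j) astar) &
      forall k : 'I_r, wk k = convolve lam u w alpha (v j) (bstar k)].
Proof.
move=> v wk.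
have [u2 uo _] := u_basis.
have lam_ge0 l : 0 <= lam l by rewrite -lam0; apply: lam_nondecreasing.
have act_le l := active_le lam alpha j l (lam_ge0 l) alpha_supp.
(* The active set is finite because lam tends to infinity while active frequencies stay below
   2^j. *)
have [N actN] : exists N, active lam alpha j `<=` `I_N.
  have /cvgryPgt /(_ (2 ^+ j)) [N _ lamN] := lam_infty.
  exists N => l /act_le lam_le /=; rewrite ltnNge; apply/negP => /lamN /=.
  by rewrite ltNge lam_le.
have /andP[A_gt0 _] := AB j.
have j_gt0 : (0 < j)%N by exact: leq_trans J_lt_j.
(* Lowering the level doubles the argument, as in the refinement equations; j > 0 makes [j.-1] a
   true predecessor. *)
have two_scale l : lam l / 2 ^+ j.-1 = 2 * (lam l / 2 ^+ j).
  by rewrite -[in RHS](prednK j_gt0) exprS invfM mulrCA mulVKf// mulrC.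
have alpha0P i l : ~ active lam alpha i l -> fourier alpha (lam l / 2 ^+ i) = 0.
  by move=> /negP; rewrite negbK => /eqP.
have alphaN l : (N <= l)%N -> fourier alpha (lam l / 2 ^+ j) = 0.
  by move=> Nl; apply: alpha0P => /actN /=; rewrite ltnNge Nl.
pose coef (gen : R -> R[i]) i l := conjc (fourier gen (lam l / 2 ^+ i)) *
  inner mu (f : borel M -> R[i]) (u l).
have coefP gen i :
    (forall l, ~ active lam alpha j l -> fourier gen (lam l / 2 ^+ i) = 0) ->
    spectral_space (active lam alpha j) (coef gen i).
  by move=> gen0 l /gen0; rewrite /coef => ->; rewrite conjc0 mul0r.
(* The scale i, the node level k and the active set of level j are kept apart: v_j has i = k = j,
   v_(j-1) has i = k = j - 1, and w^k_(j-1) has scale j - 1 on the nodes of level j. *)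
have nodal gen i k :
    (forall l, ~ active lam alpha j l -> fourier gen (lam l / 2 ^+ i) = 0) ->
    nodal_seq X w k (framelet_coeff lam u mu f gen i) =
    synthesis u X w (active lam alpha j) k (coef gen i).
  move=> gen0; apply/ffunP => x; rewrite ffunE.
  rewrite (synthesis_sum u X w _ k N _ x actN (coefP _ _ gen0)).
  rewrite (framelet_coeff_sum _ _ _ _ _ _ N)// => l Nl.
  by apply: gen0 => /actN /=; rewrite ltnNge Nl.
have alpha_pred l : fourier alpha (lam l / 2 ^+ j.-1) =
    fourier_series a (lam l / 2 ^+ j) * fourier alpha (lam l / 2 ^+ j).
  by rewrite two_scale.
have beta_pred k l : fourier (beta k) (lam l / 2 ^+ j.-1) =
    fourier_series (b k) (lam l / 2 ^+ j) * fourier alpha (lam l / 2 ^+ j).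
  by rewrite two_scale.
have vE : v j = Fmap lam u X w alpha j (coef alpha j).
  exact: nodal (alpha0P j).
have svE z : spectral_space (active lam alpha j) z ->
    spectral_vector lam u w alpha (Fmap lam u X w alpha j z) = z.
  exact: (Fmap_spectral_vector lam u X w mu alpha j N (A j) (B j)
    u2 uo (w_pos j) A_gt0 (MZ j) actN act_le z).
have convE h hstar gen : is_adjoint_filter h hstar ->
    (forall l, fourier gen (lam l / 2 ^+ j.-1) =
      fourier_series h (lam l / 2 ^+ j) * fourier alpha (lam l / 2 ^+ j)) ->
    convolve lam u w alpha (v j) hstar =
    Fmap lam u X w alpha j (coef gen j.-1).
  move=> [_ hstarE] genE; rewrite /convolve vE svE; last first.
    exact: coefP (alpha0P j).
  (* Conjugating the refinement equation, conj(h^) times conj(alpha^) at level j is conj(gen^) at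
     level j - 1. *)
  congr Fmap; apply/funext => l; rewrite hstarE /coef genE.
  by rewrite [in RHS]rmorphM /= mulrC mulrA.
have gen_pred0 h gen : (forall l, fourier gen (lam l / 2 ^+ j.-1) =
      fourier_series h (lam l / 2 ^+ j) * fourier alpha (lam l / 2 ^+ j)) ->
    forall l, ~ active lam alpha j l -> fourier gen (lam l / 2 ^+ j.-1) = 0.
  by move=> genE l /alpha0P al0; rewrite genE al0 mulr0.
split.
- by exists (coef alpha j) => //; exact: coefP (alpha0P j).
(* Downsampling keeps the spectral vector and the active set of level j and changes only the nodes,
   so [nodal] with k = j - 1 concludes. *)
- rewrite (convE _ _ _ astarP alpha_pred) /downsample svE.
    exact: nodal (gen_pred0 _ _ alpha_pred).
  exact: coefP (gen_pred0 _ _ alpha_pred).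
- move=> k; rewrite (convE _ _ _ (bstarP k) (beta_pred k)).
  exact: nodal (gen_pred0 _ _ (beta_pred k)).
Qed.
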